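(* Let $t\ge 1$ and let $S \subseteq \mathbb{Z}_2^t$ be a set containing no non-trivial solutions to the equation $s_1 + s_2 = s'_1 + s'_2$ (with $s_1,s_2,s'_1,s'_2\in S$). Let $\epsilon>0$ and suppose that $\lambda(\mathrm{Cay}(\mathbb{Z}_2^t, S)) \leq (1 - \epsilon)|S|$. Then the hypergraph $H(\mathbb{Z}_2^t, S)$ is an $\frac{\epsilon^2}{128}$-edge-expander and an $\frac{\epsilon^2}{64} |S|$-triple-expander.
   Context: For $S\subseteq\mathbb{Z}_2^t$, $\mathrm{Cay}(\mathbb{Z}_2^t,S)$ is the graph on vertex set $\mathbb{Z}_2^t$ in which $x,y$ are adjacent iff $x+y\in S$. For a $d$-regular graph $G$ on $n$ vertices with adjacency eigenvalues $\lambda_1\ge\dots\ge\lambda_n$, $\lambda(G)=\max_{i\neq 1}|\lambda_i|$. A solution of $s_1+s_2=s'_1+s'_2$ is trivial if $\{s_1,s_2\}=\{s'_1,s'_2\}$ as multisets. $H(\mathbb{Z}_2^t,S)$ is the $3$-uniform hypergraph with vertex set $\mathbb{Z}_2^t$ whose edges (called triples) are all sets $\{x+s_1,x+s_2,x+s_3\}$ with $x\in\mathbb{Z}_2^t$ and $s_1,s_2,s_3$ distinct elements of $S$. For a $3$-uniform hypergraph $H$ with triple set $T$, its skeleton $E$ is the set of pairs $\{u,v\}$ of distinct vertices contained in some triple of $H$ (elements of $E$ are called edges). For $F\subseteq E$, let $\Delta(F)$ be the set of triples all three of whose 2-subsets lie in $F$, and define $N_E(F)=\{e\in E\setminus F :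 e\cup f\in T \text{ for some } f\in F\}$ and $N_T(F)=\{t\in T: t\supset f \text{ for some } f\in F,\ t\notin\Delta(F)\}$. Let $h_E(H)=\min |N_E(F)|/|F|$ and $h_T(H)=\min |N_T(F)|/|F|$, the minima over nonempty $F\subseteq E$ with $|F|\le |E|/2$. $H$ is an $\epsilon$-edge-expander if $h_E(H)\ge\epsilon$ and an $\epsilon$-triple-expander if $h_T(H)\ge \epsilon$. *)

(* Defs.v *)
From HB Require Import structures.
From mathcomp Require Import all_boot all_order all_algebra.
From mathcomp Require Import polyrcf.
From mathcomp Require Import reals constructive_ereal.

Set Implicit Arguments.
Unset Strict Implicit.
Unset Printing Implicit Defensive.

Import Order.TTheory GRing.Theory Num.Theory.
Local Open Scope ring_scope.

(* Graph spectra.  A graph on a finType V is given by its adjacency relation;  *)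
(* loops are allowed (Cay(Z_2^t, S) has a loop at every vertex when 0 \in S).  *)

Definition adjacency (R : nzRingType) (V : finType) (e : rel V) : 'M[R]_#|V| :=
  \matrix_(i, j) (e (enum_val i) (enum_val j))%:R.

(* The real eigenvalues lambda_1 >= lambda_2 >= ..., repeated according to     *)
(* multiplicity; rootsR lists the distinct real roots in increasing order.     *)
Definition eigenvalues (R : realType) n (A : 'M[R]_n) : seq R :=
  flatten [seq nseq (mup x (char_poly A)) x | x <- rev (rootsR (char_poly A))].

(* max_{i <> 1} |lambda_i| *)
Definition graph_lambda (R : realType) (V : finType) (e : rel V) : R :=
  \big[Num.max/0]_(x <- behead (eigenvalues (adjacency R e))) `|x|.

Definition cayley (t : nat) (S : {set 'rV['Z_2]_t}) : rel 'rV['Z_2]_t :=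
  [rel x y | x + y \in S].

(* In characteristic 2, s + s = s' + s' always holds; as usual, these          *)
(* unavoidable solutions count as trivial, along with those where              *)
(* {s1, s2} = {s1', s2'} as multisets.  Counting them as non-trivial would     *)
(* force #|S| <= 1 (see multiset_trivial_only_card below).                     *)
Definition trivial_solution (V : zmodType) (s1 s2 s1' s2' : V) : Prop :=
  perm_eq [:: s1; s2] [:: s1'; s2'] \/ (s1 = s2 /\ s1' = s2').

Definition no_nontrivial_solution (t : nat) (S : {set 'rV['Z_2]_t}) : Prop :=
  forall s1 s2 s1' s2', s1 \in S -> s2 \in S -> s1' \in S -> s2' \in S ->
    s1 + s2 = s1' + s2' -> trivial_solution s1 s2 s1' s2'.

(* 3-uniform hypergraphs on V, given by their set of triples T. *)
Section Hypergraph.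
Variables (V : finType) (T : {set {set V}}).
Implicit Type F : {set {set V}}.

Definition skeleton : {set {set V}} :=
  [set e : {set V} | (#|e| == 2) && [exists u in T, e \subset u]].

Definition Delta F : {set {set V}} :=
  [set u in T | [forall e : {set V}, (#|e| == 2) && (e \subset u) ==> (e \in F)]].

Definition N_E F : {set {set V}} :=
  [set e in skeleton :\: F | [exists f in F, e :|: f \in T]].

Definition N_T F : {set {set V}} :=
  [set u in T :\: Delta F | [exists f in F, f \subset u]].

Definition admissible F : bool :=
  [&& F != set0, F \subset skeleton & (2 * #|F| <= #|skeleton|)%N].

(* The minimum over the empty family (which occurs only when T has no triple)  *)
(* is +oo.                                                                     *)
Definition h_E (R : realType) : \bar R :=
  \big[Order.min/+oo%E]_(F | admissible F) (#|N_E F|%:R / #|F|%:R)%:E.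

Definition h_T (R : realType) : \bar R :=
  \big[Order.min/+oo%E]_(F | admissible F) (#|N_T F|%:R / #|F|%:R)%:E.

Definition edge_expander (R : realType) (eps : R) : Prop := (eps%:E <= h_E R)%E.

Definition triple_expander (R : realType) (eps : R) : Prop :=
  (eps%:E <= h_T R)%E.

End Hypergraph.

Definition cayley_hypergraph (t : nat) (S : {set 'rV['Z_2]_t}) :
    {set {set 'rV['Z_2]_t}} :=
  [set u : {set 'rV['Z_2]_t} | [exists x : 'rV['Z_2]_t, exists s1 in S,
     exists s2 in S, exists s3 in S,
       [&& s1 != s2, s1 != s3, s2 != s3
         & u == [set x + s1; x + s2; x + s3]]]].

(* Comparison with the reading in which only the multiset condition is trivial *)

Lemma multiset_trivial_only (t : nat) (S : {set 'rV['Z_2]_t}) :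
  (forall s1 s2 s1' s2', s1 \in S -> s2 \in S -> s1' \in S -> s2' \in S ->
     s1 + s2 = s1' + s2' -> perm_eq [:: s1; s2] [:: s1'; s2']) ->
  no_nontrivial_solution S.
Proof. by move=> H s1 s2 s1' s2' h1 h2 h3 h4 e; left; apply: H. Qed.

Lemma multiset_trivial_only_card (t : nat) (S : {set 'rV['Z_2]_t}) :
  (forall s1 s2 s1' s2', s1 \in S -> s2 \in S -> s1' \in S -> s2' \in S ->
     s1 + s2 = s1' + s2' -> perm_eq [:: s1; s2] [:: s1'; s2']) ->
  (#|S| <= 1)%N.
Proof.
move=> H; apply/card_le1P => x xS y; rewrite inE; apply/idP/eqP => [yS|-> //].
have char2 (z : 'rV['Z_2]_t) : z + z = 0.
  by apply/matrixP => i j; rewrite !mxE; case: (z i j) => [[|[|]]] // k; apply/val_inj.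
have /perm_mem/(_ y) := H x x y y xS xS yS yS (etrans (char2 x) (esym (char2 y))).
by rewrite !inE !orbb eqxx => /eqP.
Qed.

(* The list of eigenvalues is sorted, and it is the whole spectrum as soon as  *)
(* the characteristic polynomial splits (e.g. for a symmetric matrix).         *)

Lemma eigenvalues_sorted (R : realType) n (A : 'M[R]_n) :
  sorted >=%R (eigenvalues A).
Proof.
rewrite /eigenvalues; set f := fun x => nseq _ x.
have: sorted >%R (rev (rootsR (char_poly A))).
  by rewrite rev_sorted; exact: sorted_roots.
have ge_tr : transitive (>=%R : rel R) by move=> a b c /= ba ac; exact: le_trans ac ba.
have gt_tr : transitive (>%R : rel R) by move=> a b c /= ba ac; exact: lt_trans ac ba.
rewrite !sorted_pairwise //; elim: rev => //= x s IH /andP[xs /IH {}IH].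
rewrite pairwise_cat IH andbT; apply/andP; split.
  apply/allrelP => a b; rewrite mem_nseq => /andP[_ /eqP->].
  case/flattenP => _ /mapP[y ys ->]; rewrite mem_nseq => /andP[_ /eqP->].
  by apply: ltW; move/allP: xs; apply.
rewrite /f; elim: (mup x (char_poly A)) => //= m ->; rewrite andbT; apply/allP => y.
by rewrite mem_nseq => /andP[_ /eqP->] /=.
Qed.

Lemma eigenvalues_split (R : realType) n (A : 'M[R]_n) (s : seq R) :
  char_poly A = \prod_(x <- s) ('X - x%:P) -> perm_eq (eigenvalues A) s.
Proof.
move=> As; apply/allP => x _ /=; rewrite /eigenvalues.
have pN0 : char_poly A != 0 by rewrite monic_neq0 ?char_poly_monic.
rewrite -(mu_prod_XsubC x s) -As count_flatten -map_comp.
set r := rootsR _; have ur : uniq (rev r) by rewrite rev_uniq uniq_roots.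
have -> : [seq (count_mem x \o (fun y => nseq (mup y (char_poly A)) y)) y | y <- rev r]
   = [seq ((y == x) * mup y (char_poly A))%N | y <- rev r].
  by apply: eq_map => y /=; rewrite count_nseq.
have -> : sumn [seq ((y == x) * mup y (char_poly A))%N | y <- rev r]
   = ((x \in rev r) * mup x (char_poly A))%N.
  elim: (rev r) ur => //= y q IH /andP[yq /IH ->]; rewrite inE (eq_sym x).
  by case: eqP => [<-|] //=; rewrite (negPf yq) addn0.
rewrite mem_rev -(roots_on_rootsR pN0) in_itv /=.
by case: (boolP (root _ x)) => [_|/mupNroot ->]; rewrite ?mul1n.
Qed.

(* Main.v *)
(* Every x gives a clique x + S of the skeleton; let g x be the fraction of    *)
(* its pairs that lie in F. Since S has no nontrivial solutions, every edge    *)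
(* lies in exactly two cliques x + S and x + s + s' + S, so g has mean at most *)
(* 1/2. The spectral gap, applied to the square of the Cayley graph (the walk  *)
(* x -> x + s + s'), bounds the variance of g by its variation between cliques *)
(* sharing an edge, and this variation is at most a constant times             *)
(* sum g (1 - g). Hence sum g (1 - g) >= (eps / 6) sum g: many cliques contain *)
(* a positive fraction both of pairs in F and of pairs outside F. Inside one   *)
(* clique, de Caen's bound on the sum of squared degrees turns g (1 - g) into  *)
(* many paths of length two with one edge in F and the other outside F, and    *)
(* each such path yields an element of N_E F and an element of N_T F.          *)
Require Import Defs.
From mathcomp Require Import all_boot all_order all_algebra.
From mathcomp Require Import reals constructive_ereal.
From mathcomp Require Import mxpoly.
From mathcomp Require Import ring lra.

Set Implicit Arguments.
Unset Strict Implicit.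
Unset Printing Implicit Defensive.

Import Order.TTheory GRing.Theory Num.Theory.
Local Open Scope ring_scope.

(** Let n = |S| and let g x be the density of F in the clique x + S. Expansion in characters turns
    the hypothesis on [graph_lambda] into a contraction estimate ([spectral_gap]): taking neighbor
    sums multiplies the L2 norm of the mean-zero part by at most (1 - eps) n. So the variance of g
    is controlled by its variation along two-step walks, which [local_variation_le] bounds by a
    multiple of sum g (1 - g). As g has mean at most 1/2, [dispersion_ge] follows. Call a cherry a
    path of length two inside a clique x + S, with one edge in F and the other a skeleton edge
    outside F. By [cherries_ge] there are at least (eps / 3) n |F| cherries. Since S has no
    nontrivial solutions, a given edge outside F serves in at most 4 n of them ([pair_preimages]),
    and a given triple carries at most 9 ([triple_preimages]). Hence |N_E F| >= (eps / 12) |F| and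
    |N_T F| >= (eps / 27) n |F|; as eps <= 1, these imply the stated bounds. *)

Lemma char_poly_similar (F : fieldType) n (P A B : 'M[F]_n) :
  P \in unitmx -> P *m A = B *m P -> char_poly A = char_poly B.
Proof.
move=> Pu PAB; have detP0 : (\det P)%:P != 0 by rewrite polyC_eq0 -unitfE -unitmxE.
apply: (mulfI detP0); rewrite [RHS]mulrC -det_map_mx /char_poly -!det_mulmx.
rewrite /char_poly_mx mulmxBr mulmxBl -!map_mxM PAB.
by rewrite scalar_mxC.
Qed.

(** * Fourier analysis on Z_2^t and the spectrum of the Cayley graph *)

Section Characters.
Variables (R : realType) (t : nat).
Local Notation V := 'rV['Z_2]_t.
Implicit Types a x y : V.

Lemma rowZ2_addrr x : x + x = 0.
Proof.
by apply/matrixP => i j; rewrite !mxE; case: (x i j) => [[|[|]]] // k; apply/val_inj.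
Qed.

Lemma rowZ2_addrK y x : x + y + y = x.
Proof. by rewrite -addrA rowZ2_addrr addr0. Qed.

Lemma rowZ2_eq_add x y z : (x + y == z) = (x == z + y).
Proof. by rewrite -(inj_eq (addIr y)) rowZ2_addrK. Qed.

Lemma sum_rowZ2_shift (f : V -> R) y : \sum_x f (x + y) = \sum_x f x.
Proof. by rewrite [RHS](reindex_inj (addIr y)). Qed.

Definition chi a x : R := (-1) ^+ (val ((a *m x^T) 0 0)).

Lemma chi_sym a x : chi a x = chi x a.
Proof. by rewrite /chi -[a *m x^T]trmxK trmx_mul trmxK mxE. Qed.

Lemma chiD a x y : chi a (x + y) = chi a x * chi a y.
Proof.
rewrite /chi linearD mulmxDr mxE -exprD.
move: ((a *m x^T) 0 0) ((a *m y^T) 0 0) => [[|[|]] // i] [[|[|]] // j] //=;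
  by rewrite !expr2 mulrNN mulr1.
Qed.

Lemma chi0 a : chi a 0 = 1.
Proof. by rewrite /chi trmx0 mulmx0 mxE. Qed.

(** Translation by a basis vector on which [chi a] is -1 negates the sum. *)
Lemma sum_chi_neq0 a : a != 0 -> \sum_x chi a x = 0.
Proof.
move=> a0; have [j aj] : exists j, a 0 j != 0.
  apply/existsP; apply: contraR a0; rewrite negb_exists => /forallP H.
  by apply/eqP/rowP => j; rewrite mxE; apply/eqP; rewrite -[_ == _]negbK.
pose e : V := delta_mx 0 j.
have che : chi a e = -1.
  rewrite /chi /e trmx_delta -colE mxE.
  by case: (a 0 j) aj => [[|[|]]].
have /eqP := sum_rowZ2_shift (chi a) e.
under eq_bigr do rewrite chiD che.
by rewrite -mulr_suml mulrN1 eq_sym -addr_eq0 -mulr2n mulrn_eq0 => /eqP.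
Qed.

Lemma sum_chi a : \sum_x chi a x = #|{: V}|%:R * (a == 0)%:R.
Proof.
have [->|a0] := eqVneq; last by rewrite sum_chi_neq0 ?mulr0.
by under eq_bigr do rewrite chi_sym chi0; rewrite sumr_const mulr1.
Qed.

Lemma chi_orthogonal x y : \sum_a chi a x * chi a y = #|{: V}|%:R * (x == y)%:R.
Proof.
under eq_bigr do rewrite -chiD chi_sym.
by rewrite sum_chi rowZ2_eq_add add0r.
Qed.

Definition fourier (f : V -> R) a : R := \sum_x f x * chi a x.

Lemma parseval f : \sum_a fourier f a ^+ 2 = #|{: V}|%:R * \sum_x f x ^+ 2.
Proof.
transitivity (\sum_x \sum_y f x * f y * \sum_a chi a x * chi a y).
  under eq_bigr do rewrite expr2 /fourier big_distrlr /=.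
  rewrite exchange_big; apply: eq_bigr => x _; rewrite exchange_big.
  by apply: eq_bigr => y _; rewrite mulr_sumr; apply: eq_bigr => a _; ring.
rewrite mulr_sumr; apply: eq_bigr => x _.
rewrite (bigD1 x) //= chi_orthogonal eqxx big1 ?addr0 => [|y yx]; last first.
  by rewrite chi_orthogonal eq_sym (negPf yx) !mulr0.
by rewrite mulr1 -expr2 mulrC.
Qed.

Variable S : {set V}.

Definition neighbor_sum (f : V -> R) x : R := \sum_(s in S) f (x + s).

Definition cayley_eigenvalue a : R := \sum_(s in S) chi a s.

Lemma fourier_neighbor_sum f a :
  fourier (neighbor_sum f) a = cayley_eigenvalue a * fourier f a.
Proof.
rewrite /fourier /neighbor_sum /cayley_eigenvalue mulr_suml.
under eq_bigr do rewrite mulr_suml.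
rewrite exchange_big; apply: eq_bigr => s _.
rewrite -(sum_rowZ2_shift _ s) mulr_sumr; apply: eq_bigr => x _.
by rewrite rowZ2_addrK chiD; ring.
Qed.

Lemma cayley_eigenvalue0 : cayley_eigenvalue 0 = #|S|%:R.
Proof.
by rewrite /cayley_eigenvalue; under eq_bigr do rewrite chi_sym chi0; rewrite sumr_const.
Qed.

Lemma cayley_eigenvalue_max a : cayley_eigenvalue a <= #|S|%:R.
Proof.
rewrite -cayley_eigenvalue0; apply: ler_sum => s _; rewrite (chi_sym 0) chi0.
by rewrite /chi -signr_odd; case: odd; rewrite ?expr1 ?expr0 //; lra.
Qed.

Lemma card_rowZ2_gt0 : 0 < #|{: V}|%:R :> R.
Proof. by rewrite ltr0n; apply/card_gt0P; exists 0. Qed.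

(** The character table P diagonalizes the adjacency matrix, and it is invertible because P^2 is |V|
    times the identity. *)
Lemma char_poly_cayley :
  char_poly (adjacency R (cayley S)) =
  \prod_(l <- [seq cayley_eigenvalue a | a : V]) ('X - l%:P).
Proof.
pose P : 'M[R]_#|V| := \matrix_(i, j) chi (enum_val i) (enum_val j).
pose D : 'rV[R]_#|V| := \row_i cayley_eigenvalue (enum_val i).
have sum_enum (F : V -> R) : \sum_(k < #|V|) F (enum_val k) = \sum_x F x.
  by rewrite (reindex _ (onW_bij _ (enum_val_bij V))).
have PP : P *m P = #|V|%:R%:M.
  apply/matrixP => i j; rewrite !mxE.
  under eq_bigr do rewrite !mxE (chi_sym (enum_val i)).
  rewrite (sum_enum (fun x => chi x (enum_val i) * chi x (enum_val j))).
  by rewrite chi_orthogonal (inj_eq enum_val_inj) mulr_natr.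
have Pu : P \in unitmx.
  suff /mulmx1_unit[] : P *m (#|V|%:R^-1 *: P) = 1%:M by [].
  rewrite -scalemxAr PP scale_scalar_mx mulVf //.
  by rewrite gt_eqF ?card_rowZ2_gt0.
have PAD : P *m adjacency R (cayley S) = diag_mx D *m P.
  apply/matrixP => i j; rewrite mul_diag_mx !mxE.
  under eq_bigr do rewrite !mxE.
  set a := enum_val i; set x := enum_val j.
  rewrite (sum_enum (fun y => chi a y * (cayley S y x)%:R)).
  rewrite -(sum_rowZ2_shift _ x) /cayley_eigenvalue mulr_suml [RHS]big_mkcond.
  apply: eq_bigr => y _.
  have -> : cayley S (y + x) x = (y \in S) by rewrite -{2}(rowZ2_addrK x y).
  rewrite chiD.
  by case: (y \in S); rewrite ?mulr1 ?mulr0.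
rewrite (char_poly_similar Pu PAD) char_poly_trig ?diag_mx_is_trig //.
rewrite big_map big_enum /= [RHS](reindex _ (onW_bij _ (enum_val_bij V))) /=.
by apply: eq_bigr => i _; rewrite !mxE eqxx.
Qed.

(** [graph_lambda] drops the head of the sorted spectrum. That head is |S|, the value at the trivial
    character and the largest of all, so what remains is exactly the multiset of values at nonzero
    characters. *)
Lemma cayley_eigenvalue_bound a :
  a != 0 -> `|cayley_eigenvalue a| <= graph_lambda R (cayley S).
Proof.
move=> a0; have es := eigenvalues_split char_poly_cayley.
have := eigenvalues_sorted (adjacency R (cayley S)).
rewrite /graph_lambda; move: es.
case: (eigenvalues _) => [|l r] es.
  by have /perm_size := es; rewrite size_map -cardT;
    have := card_rowZ2_gt0; rewrite ltr0n; case: #|_|.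
rewrite /= (path_sortedE (@ge_trans _ R)) => /andP[/allP lr _].
have lE : l = #|S|%:R.
  apply/eqP; rewrite eq_le; apply/andP; split.
    have : l \in [seq cayley_eigenvalue a | a : V] by rewrite -(perm_mem es) mem_head.
    by case/mapP => b _ ->; exact: cayley_eigenvalue_max.
  have : #|S|%:R \in l :: r.
    by rewrite (perm_mem es) -cayley_eigenvalue0 map_f // mem_enum.
  by rewrite inE => /predU1P[->//|/lr].
have : perm_eq r [seq cayley_eigenvalue b | b <- rem 0 (enum V)].
  have /perm_to_rem p0 : (0 : V) \in enum V by rewrite mem_enum.
  have := perm_map cayley_eigenvalue p0.
  by move/(perm_trans es); rewrite /= cayley_eigenvalue0 lE perm_cons.
move=> /perm_mem rE; apply: (@le_bigmax_seq _ _ _ r 0 _ xpredT (fun x : R => `|x|)) => //.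
by rewrite rE map_f // mem_rem_uniq ?enum_uniq // inE a0 mem_enum.
Qed.

Lemma spectral_gap_le1 (eps : R) : 0 < #|S|%:R :> R ->
  graph_lambda R (cayley S) <= (1 - eps) * #|S|%:R -> eps <= 1.
Proof.
move=> n0 gap; have : 0 <= (1 - eps) * #|S|%:R.
  by apply: le_trans gap; exact: bigmax_ge_id.
by rewrite pmulr_lge0 // subr_ge0.
Qed.

(** By Parseval, the trivial character keeps its factor |S|^2 and every other coefficient is damped
    by (1 - eps)^2 |S|^2. *)
Lemma spectral_gap (eps : R) (f : V -> R) :
  graph_lambda R (cayley S) <= (1 - eps) * #|S|%:R ->
  \sum_x neighbor_sum f x ^+ 2 <=
  #|S|%:R ^+ 2 * ((1 - eps) ^+ 2 * \sum_x f x ^+ 2 +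
     (1 - (1 - eps) ^+ 2) * ((\sum_x f x) ^+ 2 / #|{: V}|%:R)).
Proof.
move=> gap; have N0 := card_rowZ2_gt0.
rewrite -(ler_pM2l N0) -parseval.
have f0 : fourier f 0 = \sum_x f x.
  by apply: eq_bigr => x _; rewrite chi_sym chi0 mulr1.
under eq_bigr do rewrite fourier_neighbor_sum exprMn.
have := parseval f; rewrite (bigD1 0) //= f0 => pf.
rewrite [leLHS](bigD1 0) //= f0 cayley_eigenvalue0.
have le : \sum_(a | a != 0) cayley_eigenvalue a ^+ 2 * fourier f a ^+ 2 <=
    ((1 - eps) * #|S|%:R) ^+ 2 * \sum_(a | a != 0) fourier f a ^+ 2.
  rewrite mulr_sumr; apply: ler_sum => a a0; apply: ler_wpM2r; first exact: sqr_ge0.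
  rewrite -[leLHS]real_normK ?num_real //; apply: lerXn2r; rewrite ?nnegrE //.
    exact: le_trans (le_trans (normr_ge0 _) (cayley_eigenvalue_bound a0)) gap.
  exact: le_trans (cayley_eigenvalue_bound a0) gap.
apply: le_trans (lerD (lexx _) le) _.
rewrite le_eqVlt; apply/orP; left; apply/eqP.
have -> : \sum_(a | a != 0) fourier f a ^+ 2 =
    #|{: V}|%:R * (\sum_x f x ^+ 2) - (\sum_x f x) ^+ 2 by rewrite -pf addrAC subrr add0r.
by field; rewrite gt_eqF.
Qed.

End Characters.

(** * De Caen's inequality and paths of length two in a graph *)

Section DegreeSquares.
Variables (R : realFieldType) (I : finType) (S : {set I}) (phi : I -> I -> R).
Hypotheses (phi_sym : forall i j, phi i j = phi j i)
  (phi_idem : forall i j, phi i j ^+ 2 = phi i j)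
  (phi_irr : forall i, phi i i = 0)
  (S_ge3 : (2 < #|S|)%N).

Let n : R := #|S|%:R.
Let deg i : R := \sum_(j in S) phi i j.
Let M : R := \sum_(i in S) deg i.

(** [phi] is the adjacency indicator of a simple graph on S and M counts ordered pairs, so with e =
    M / 2 edges this is the usual bound e (2 e / (n - 1) + n - 2). *)
Lemma de_Caen :
  \sum_(i in S) deg i ^+ 2 <= M / 2 * (M / (n - 1) + (n - 2)).
Proof.
have n3 : 3 <= n by rewrite /n ler_nat.
have sum_cst (x : R) : \sum_(i in S) x = n * x by rewrite sumr_const mulr_natl.
pose W : R := \sum_(i in S) deg i ^+ 2.
have full q c : \sum_(i in S) \sum_(j in S) (phi i j - q * deg i - q * deg j - c) ^+ 2 =
    M + 2 * n * q ^+ 2 * W + n ^+ 2 * c ^+ 2 - 4 * q * W - 2 * c * M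
    + 2 * q ^+ 2 * M ^+ 2 + 4 * q * n * c * M.
  have degE j : \sum_(i in S) phi i j = deg j by apply: eq_bigr => i _.
  have phideg : \sum_(i in S) \sum_(j in S) phi i j * deg j = W.
    rewrite exchange_big; apply: eq_bigr => j _.
    by rewrite -mulr_suml degE expr2.
  have inner i : \sum_(j in S) (phi i j - q * deg i - q * deg j - c) ^+ 2 =
     (1 - 2 * c + 2 * q ^+ 2 * M + 2 * n * q * c) * deg i
     + (n * q ^+ 2 - 2 * q) * deg i ^+ 2
     + (- 2 * q) * (\sum_(j in S) phi i j * deg j)
     + (n * c ^+ 2 + q ^+ 2 * W + 2 * q * c * M).
    pose u := q * deg i + c.
    transitivity (\sum_(j in S) ((1 - 2 * u) * phi i j + u ^+ 2 +
        q ^+ 2 * deg j ^+ 2 + (- 2 * q) * (phi i j * deg j) + 2 * q * u * deg j)).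
      apply: eq_bigr => j _.
      have -> : (1 - 2 * u) * phi i j = phi i j ^+ 2 - 2 * u * phi i j.
        by rewrite phi_idem; ring.
      by rewrite /u; ring.
    rewrite !big_split /= !sum_cst -!mulr_sumr.
    by rewrite -/(deg i) -/W -/M /u; ring.
  under eq_bigr do rewrite inner.
  rewrite !big_split /= !sum_cst -!mulr_sumr.
  by rewrite -/W -/M phideg; ring.
(* The diagonal terms i = j, where [phi] vanishes; removing them from [full] leaves the squared
   error over pairs of distinct vertices. *)
have diag q c : \sum_(i in S) (2 * q * deg i + c) ^+ 2 =
    4 * q ^+ 2 * W + 4 * q * c * M + n * c ^+ 2.
  transitivity (\sum_(i in S) (4 * q ^+ 2 * deg i ^+ 2 + 4 * q * c * deg i + c ^+ 2)).
    by apply: eq_bigr => i _; ring.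
  by rewrite !big_split /= !sum_cst -!mulr_sumr.
(* Off the diagonal, g + q (deg i - (n - 1) g) + q (deg j - (n - 1) g) with    *)
(* g = M / (n (n - 1)) is the least-squares fit of phi by a sum a_i + a_j;     *)
(* the inequality says that its squared error is nonnegative.                  *)
pose q : R := (n - 2)^-1.
pose c : R := M / (n * (n - 1)) * (1 - 2 * q * (n - 1)).
have le : \sum_(i in S) (2 * q * deg i + c) ^+ 2 <=
    \sum_(i in S) \sum_(j in S) (phi i j - q * deg i - q * deg j - c) ^+ 2.
  apply: ler_sum => i iS; rewrite [leRHS](bigD1 i) //= phi_irr.
  rewrite -[leLHS]addr0; apply: lerD; last by apply: sumr_ge0 => j _; exact: sqr_ge0.
  by rewrite le_eqVlt; apply/orP; left; apply/eqP; ring.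
move: le; rewrite full diag -subr_ge0 => le.
rewrite -subr_ge0 -/W.
have -> : M / 2 * (M / (n - 1) + (n - 2)) - W = (n - 2) / 2 *
  (M + 2 * n * q ^+ 2 * W + n ^+ 2 * c ^+ 2 - 4 * q * W - 2 * c * M
    + 2 * q ^+ 2 * M ^+ 2 + 4 * q * n * c * M
    - (4 * q ^+ 2 * W + 4 * q * c * M + n * c ^+ 2)).
  by rewrite /c /q; field; rewrite !gt_eqF //; lra.
by apply: mulr_ge0 => //; lra.
Qed.

(** The right side counts paths of length two with one edge in the graph and one in its complement.
    With edge density g, the left side is n / 2 times n (n - 1) g (1 - g). *)
Lemma cherries_ge :
  n / 2 * (M - M ^+ 2 / (n * (n - 1))) <= \sum_(i in S) deg i * (n - 1 - deg i).
Proof.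
have n3 : 3 <= n by rewrite /n ler_nat.
have -> : \sum_(i in S) deg i * (n - 1 - deg i) = (n - 1) * M - \sum_(i in S) deg i ^+ 2.
  rewrite mulr_sumr -sumrB; apply: eq_bigr => i _; ring.
have -> : n / 2 * (M - M ^+ 2 / (n * (n - 1))) =
    (n - 1) * M - M / 2 * (M / (n - 1) + (n - 2)).
  by field; rewrite !gt_eqF //; lra.
by have := de_Caen; lra.
Qed.

End DegreeSquares.

(** * Dispersion of the clique densities *)

Section LocalDensity.
Variables (R : realType) (t : nat).
Local Notation V := 'rV['Z_2]_t.
Variables (S : {set V}) (phi : V -> V -> V -> R).
Hypotheses (phi_idem : forall x s s', phi x s s' ^+ 2 = phi x s s')
  (phi_irr : forall x s, phi x s s = 0)
  (phi_swap : forall x s s', phi (x + s + s') s s' = phi x s s')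
  (S_ge3 : (2 < #|S|)%N).

Let n : R := #|S|%:R.
Let K : R := n * (n - 1).
Let D x : R := \sum_(s in S) \sum_(s' in S) phi x s s'.
Let B : R := \sum_x (D x - D x ^+ 2 / K).

(** Expand the square: translating x by s turns the cross term into g (x + s) g (x + s'), whose sum
    is that of the squared neighbor sums. *)
Lemma local_variation (g : V -> R) :
  \sum_x \sum_(s in S) \sum_(s' in S) (g x - g (x + s + s')) ^+ 2 =
  2 * n ^+ 2 * (\sum_x g x ^+ 2) - 2 * \sum_x neighbor_sum S g x ^+ 2.
Proof.
have sum_cst (x : R) : \sum_(s in S) x = n * x by rewrite sumr_const mulr_natl.
have shift2 (f : V -> R) : \sum_x \sum_(s in S) \sum_(s' in S) f (x + s + s') =
    n ^+ 2 * \sum_x f x.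
  rewrite exchange_big /=.
  under eq_bigr do rewrite exchange_big /=.
  under eq_bigr => s _ do under eq_bigr do
    rewrite (sum_rowZ2_shift (fun x => f (x + _))) sum_rowZ2_shift.
  by rewrite !sum_cst; ring.
have cross : \sum_x \sum_(s in S) \sum_(s' in S) g x * g (x + s + s') =
    \sum_x neighbor_sum S g x ^+ 2.
  under [RHS]eq_bigr do rewrite expr2 /neighbor_sum big_distrlr /=.
  rewrite exchange_big [RHS]exchange_big /=; apply: eq_bigr => s _.
  rewrite exchange_big [RHS]exchange_big /=; apply: eq_bigr => s' _.
  rewrite -(sum_rowZ2_shift _ s); apply: eq_bigr => x _.
  by rewrite rowZ2_addrK.
rewrite -cross.
transitivity (\sum_x \sum_(s in S) \sum_(s' in S)
   (g x ^+ 2 + g (x + s + s') ^+ 2 + (- 2) * (g x * g (x + s + s')))).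
  by do 3![apply: eq_bigr => ? _]; ring.
under eq_bigr do under eq_bigr do rewrite !big_split /= -[X in _ + X]mulr_sumr.
under eq_bigr do rewrite !big_split /= -[X in _ + X]mulr_sumr.
rewrite !big_split /= -[X in _ + X]mulr_sumr (shift2 (fun x => g x ^+ 2)).
under eq_bigr do rewrite !sum_cst.
by rewrite -!mulr_sumr; ring.
Qed.

(* The cliques x + S and x + s + s' + S share the pair {x+s, x+s'}: compare    *)
(* both densities D / K with the indicator of that pair.                       *)
Lemma local_variation_le :
  \sum_x \sum_(s in S) \sum_(s' in S) (D x / K - D (x + s + s') / K) ^+ 2 <= 4 * B.
Proof.
have n3 : 3 <= n by rewrite /n ler_nat.
have K0 : K != 0 by rewrite /K mulf_neq0 // gt_eqF //; lra.
have sum_cst (x : R) : \sum_(s in S) x = n * x by rewrite sumr_const mulr_natl.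
pose v x s s' : R := (D x / K - phi x s s') ^+ 2 * (s != s')%:R.
(* D x / K is the mean of the indicator [phi x] over the K ordered pairs of distinct elements, so
   this is K times the variance of an indicator. *)
have sum_v x : \sum_(s in S) \sum_(s' in S) v x s s' = D x - D x ^+ 2 / K.
  transitivity (\sum_(s in S) \sum_(s' in S)
     ((1 - 2 * (D x / K)) * phi x s s' + (D x / K) ^+ 2) - \sum_(s in S) (D x / K) ^+ 2).
    rewrite -sumrB; apply: eq_bigr => s sS; rewrite (bigD1 s) //= [in RHS](bigD1 s) //=.
    rewrite /v eqxx phi_irr !mulr0 !add0r addrC addrK; apply: eq_bigr => s' /andP[_ ns].
    rewrite eq_sym ns mulr1 mulrBl -{2}phi_idem; ring.
  under eq_bigr do rewrite big_split /= -mulr_sumr.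
  rewrite big_split /= -mulr_sumr -/(D x) !sum_cst.
  have nn : n ^+ 2 - n = K by rewrite /K; ring.
  have -> : D x ^+ 2 / K = D x / K * D x by ring.
  have : D x = D x / K * (n ^+ 2 - n) by rewrite nn divfK.
  by move: (D x) (D x / K) => w d ->; ring.
have shiftv : \sum_x \sum_(s in S) \sum_(s' in S) v (x + s + s') s s' = B.
  transitivity (\sum_x \sum_(s in S) \sum_(s' in S) v x s s').
    rewrite exchange_big [RHS]exchange_big /=; apply: eq_bigr => s _.
    rewrite exchange_big [RHS]exchange_big /=; apply: eq_bigr => s' _.
    exact: etrans (sum_rowZ2_shift (fun x => v (x + s') s s') s)
                  (sum_rowZ2_shift (fun x => v x s s') s').
  by apply: eq_bigr => x _.
have -> : 4 * B = \sum_x \sum_(s in S) \sum_(s' in S)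
    (2 * v x s s' + 2 * v (x + s + s') s s').
  under eq_bigr do under eq_bigr do rewrite big_split /= -!mulr_sumr.
  under eq_bigr do rewrite big_split /= -!mulr_sumr sum_v.
  by rewrite big_split /= -!mulr_sumr shiftv -/B; ring.
apply: ler_sum => x _; apply: ler_sum => s _; apply: ler_sum => s' _.
rewrite /v phi_swap; have [<-|ns] := eqVneq s s'.
  by rewrite rowZ2_addrK subrr !mulr0 expr0n addr0.
rewrite !mulr1; move: (D x / K) (D (x + s + s') / K) (phi x s s') => a b c.
(* 2 (a - c)^2 + 2 (b - c)^2 - (a - b)^2 = (a + b - 2 c)^2. *)
have := sqr_ge0 (a + b - 2 * c); nra.
Qed.

Lemma dispersion_ge (eps : R) :
  0 < eps -> graph_lambda R (cayley S) <= (1 - eps) * n ->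
  (forall x s s', 0 <= phi x s s') ->
  2 * (\sum_x D x) <= K * #|{: V}|%:R ->
  eps / 6 * \sum_x D x <= B.
Proof.
move=> eps0 gap phi0 half.
have n3 : 3 <= n by rewrite /n ler_nat.
have K0 : 0 < K by rewrite /K mulr_gt0 //; lra.
have N0 : 0 < #|{: V}|%:R :> R := card_rowZ2_gt0 _ _.
have eps1 : eps <= 1 by apply: spectral_gap_le1 gap; lra.
have Dsum0 : 0 <= \sum_x D x by do 3![apply: sumr_ge0 => ? _].
have := local_variation_le; rewrite (local_variation (fun x => D x / K)).
have := spectral_gap (fun x => D x / K) gap.
have -> : \sum_x (D x / K) ^+ 2 = (\sum_x D x - B) / K.
  rewrite /B sumrB opprB addrCA subrr addr0 mulr_suml.
  by apply: eq_bigr => x _; rewrite expr2 [in RHS]expr2; ring.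
rewrite -mulr_suml -/n.
set W := \sum_x _; set Dt := \sum_x D x in half Dsum0 *.
move=> gapW varW.
(* Mean density at most 1/2 enters here. *)
have sq : (Dt / K) ^+ 2 / #|{: V}|%:R <= Dt / K / 2.
  rewrite ler_pdivrMr // expr2 -[leRHS]mulrA ler_wpM2l ?divr_ge0 //; first exact: ltW.
  by rewrite ler_pdivrMr //; lra.
have [BD|BD] := leP (Dt / 2) B; first nra.
have nK : 1 <= n ^+ 2 / K by rewrite ler_pdivlMr // mul1r /K; nra.
have key : (n ^+ 2 / K) * (eps * (Dt / 2 - B)) <= 2 * B.
  pose d := 1 - (1 - eps) ^+ 2.
  have d_eps : eps <= d by rewrite /d; nra.
  have gapW' : W <= n ^+ 2 * ((1 - d) * ((Dt - B) / K) + d * (Dt / K / 2)).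
    apply: le_trans gapW _; apply: ler_wpM2l; first exact: sqr_ge0.
    rewrite -/d; have -> : (1 - eps) ^+ 2 = 1 - d by rewrite /d; ring.
    by apply: lerD => //; apply: ler_wpM2l => //; lra.
  apply: (@le_trans _ _ (n ^+ 2 / K * (d * (Dt / 2 - B)))).
    by apply: ler_wpM2l; [lra | apply: ler_wpM2r; lra].
  have -> : n ^+ 2 / K * (d * (Dt / 2 - B)) = n ^+ 2 * ((Dt - B) / K) -
      n ^+ 2 * ((1 - d) * ((Dt - B) / K) + d * (Dt / K / 2)) by field; rewrite gt_eqF.
  by move: varW gapW'; rewrite -mulrA; lra.
have : 1 * (eps * (Dt / 2 - B)) <= (n ^+ 2 / K) * (eps * (Dt / 2 - B)).
  by apply: ler_wpM2r => //; apply: mulr_ge0; lra.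
move=> le1; have B0 : 0 <= B.
  have : 0 <= eps * (Dt / 2 - B) by apply: mulr_ge0; lra.
  by lra.
(* From eps (Dt / 2 - B) <= 2 B and eps B <= B one gets eps Dt / 2 <= 3 B, whence the constant 6. *)
have : eps * B <= 1 * B by apply: ler_wpM2r.
by lra.
Qed.

End LocalDensity.

(** * Representations of edges and triples in the cliques x + S *)

Section CayleyHypergraph.
Variables (t : nat) (S : {set 'rV['Z_2]_t}).
Local Notation V := 'rV['Z_2]_t.
Hypothesis S_sol : no_nontrivial_solution S.
Local Notation T := (cayley_hypergraph S).

Lemma sol_unique s1 s2 s1' s2' :
    s1 \in S -> s2 \in S -> s1' \in S -> s2' \in S -> s1 != s2 ->
  s1 + s2 = s1' + s2' -> (s1 = s1' /\ s2 = s2') \/ (s1 = s2' /\ s2 = s1').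
Proof.
move=> S1 S2 S1' S2' n12 e; have [p|[e12 _]] := S_sol S1 S2 S1' S2' e; last first.
  by rewrite e12 eqxx in n12.
have := perm_mem p s1; rewrite !inE eqxx /= => /esym/orP[/eqP e1|/eqP e1].
  by left; split=> //; move: e; rewrite e1 => /addrI.
by right; split=> //; move: e; rewrite e1 addrC => /addIr.
Qed.

Lemma cayley_hypergraphP (u : {set V}) :
  reflect (exists x s1 s2 s3, [/\ [/\ s1 \in S, s2 \in S & s3 \in S],
      [/\ s1 != s2, s1 != s3 & s2 != s3] & u = [set x + s1; x + s2; x + s3]])
    (u \in T).
Proof.
rewrite inE; apply: (iffP existsP) => -[x].
  case/exists_inP=> s1 S1 /exists_inP[s2 S2] /exists_inP[s3 S3].
  by case/and4P=> n12 n13 n23 /eqP uE; exists x, s1, s2, s3.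
case=> s1 [s2] [s3] [[S1 S2 S3] [n12 n13 n23] ->]; exists x.
apply/exists_inP; exists s1 => //; apply/exists_inP; exists s2 => //.
by apply/exists_inP; exists s3; rewrite // n12 n13 n23 eqxx.
Qed.

Lemma skeleton_elim e : e \in skeleton T ->
  exists x s s', [/\ s \in S, s' \in S, s != s' & e = [set x + s; x + s']].
Proof.
rewrite inE => /andP[/cards2P[a [b [nab ->]]]] /exists_inP[u].
case/cayley_hypergraphP=> x [s1] [s2] [s3] [[S1 S2 S3] _ uE] /subsetP sub.
have el w : w \in [set a; b] -> exists2 s, s \in S & w = x + s.
  move/sub; rewrite uE !inE => /orP[/orP[]|] /eqP->; by [exists s1|exists s2|exists s3].
have [s Ss aE] := el a (set21 _ _); have [s' Ss' bE] := el b (set22 _ _).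
exists x, s, s'; split; rewrite -?aE -?bE //.
by apply: contra_neq nab => ss; rewrite aE bE ss.
Qed.

Lemma cayley_hypergraph_card_gt2 u : u \in T -> (2 < #|S|)%N.
Proof.
case/cayley_hypergraphP=> x [s1] [s2] [s3] [[S1 S2 S3] [n12 n13 n23] _].
apply: (@leq_trans #|[set s1; s2; s3]|).
  by rewrite setUC cardsU1 !inE cards2 n12 eq_sym (negPf n13) eq_sym (negPf n23).
by apply/subset_leq_card/subsetP => z; rewrite !inE => /orP[/orP[]|] /eqP->.
Qed.

Lemma skeleton_intro x s s' : (2 < #|S|)%N -> s \in S -> s' \in S -> s != s' ->
  [set x + s; x + s'] \in skeleton T.
Proof.
move=> n3 Ss Ss' ns; rewrite inE cards2 (inj_eq (addrI x)) ns /=.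
have : (0 < #|S :\: [set s; s']|)%N.
  rewrite cardsD subn_gt0 (leq_ltn_trans _ n3) //.
  by apply: leq_trans (subset_leq_card (subsetIr _ _)) _; rewrite cards2; case: (_ != _).
case/card_gt0P=> s3; rewrite !inE negb_or => /andP[/andP[n1 n2] S3].
apply/exists_inP; exists [set x + s; x + s'; x + s3].
  by apply/cayley_hypergraphP; exists x, s, s', s3; rewrite !(eq_sym _ s3) n1 n2.
exact: subsetUl.
Qed.

(** The sum of the two endpoints of e is s + s', which determines {s, s'} by [sol_unique]; two base
    points x then remain, with two orders each. *)
Lemma pair_preimages e : e \in skeleton T ->
  #|[set p : V * V * V | [&& p.1.2 \in S, p.2 \in S
       & [set p.1.1 + p.1.2; p.1.1 + p.2] == e]]| = 4.
Proof.
case/skeleton_elim=> y [a] [b] [Sa Sb nab ->].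
transitivity #|[set (y, a, b); (y, b, a); (y + a + b, a, b); (y + a + b, b, a)]|; last first.
  have ab0 : a + b != 0 by rewrite rowZ2_eq_add add0r.
  have nab' : y + a + b != y by rewrite -addrA -[X in _ != X]addr0 (inj_eq (addrI y)).
  rewrite setUC cardsU1 setUC cardsU1 cards2 !inE !xpair_eqE !eqxx.
  by rewrite (negPf nab') (eq_sym b) (negPf nab) /=.
have yab1 : y + a + b + a = y + b by rewrite addrAC rowZ2_addrK.
have yab2 : y + a + b + b = y + a by rewrite rowZ2_addrK.
apply/eq_card => -[[x s] s']; rewrite !inE /=; apply/idP/idP; last first.
  move=> /orP[/orP[/orP[]|]|] /eqP[-> -> ->]; rewrite ?Sa ?Sb ?yab1 ?yab2 ?eqxx //=;
  by rewrite setUC.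
case/and3P=> Ss Ss' /eqP eE.
have nss : x + s != x + s'.
  by have := congr1 (fun A : {set V} => #|A|) eE;
    rewrite !cards2 (inj_eq (addrI y)) nab; case: eqP.
have xs : x + s \in [set y + a; y + b] by rewrite -eE set21.
have xs' : x + s' \in [set y + a; y + b] by rewrite -eE set22.
have ss : s + s' = a + b.
  have <- : (x + s) + (x + s') = s + s' by rewrite addrACA rowZ2_addrr add0r.
  move: xs xs' nss; rewrite !inE => /orP[] /eqP-> /orP[] /eqP->; rewrite ?eqxx // => _.
    by rewrite addrACA rowZ2_addrr add0r.
  by rewrite addrACA rowZ2_addrr add0r addrC.
have {}nss : s != s' by rewrite -(inj_eq (addrI x)).
move: xs; rewrite !inE !rowZ2_eq_add !xpair_eqE.
case: (sol_unique Ss Ss' Sa Sb nss ss) => -[-> ->]; rewrite !eqxx !andbT ?rowZ2_addrK.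
  by case/orP=> /eqP->; rewrite ?eqxx ?orbT // addrAC eqxx ?orbT.
by case/orP=> /eqP->; rewrite ?eqxx ?orbT // addrAC eqxx ?orbT.
Qed.

(** A representation is determined by its triple u and the ordered pair (x + s1, x + s2), an element
    of u x u; keeping the diagonal of u x u costs only a constant. *)
Lemma triple_preimages (U : {set {set V}}) : U \subset T ->
  (#|[set p : V * V * V * V | [&& p.1.1.2 \in S, p.1.2 \in S, p.2 \in S,
       [&& p.1.1.2 != p.1.2, p.1.1.2 != p.2 & p.1.2 != p.2] &
       [set p.1.1.1 + p.1.1.2; p.1.1.1 + p.1.2; p.1.1.1 + p.2]%R \in U]]|
   <= 9 * #|U|)%N.
Proof.
move=> UT; set P := [set p | _].
pose f (p : V * V * V * V) := ([set p.1.1.1 + p.1.1.2; p.1.1.1 + p.1.2; p.1.1.1 + p.2],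
   (p.1.1.1 + p.1.1.2, p.1.1.1 + p.1.2)).
have f_inj : {in P &, injective f}.
  move=> [[[x s1] s2] s3] [[[y r1] r2] r3]; rewrite !inE /=.
  case/and5P=> S1 S2 S3 /and3P[n12 n13 n23] _.
  case/and5P=> R1 R2 R3 /and3P[m12 m13 m23] _ [eu e1 e2].
  have e3 : x + s3 = y + r3.
    have : x + s3 \in [set y + r1; y + r2; y + r3] by rewrite -eu !inE eqxx orbT.
    rewrite !inE -e1 -e2 !(inj_eq (addrI x)) !(eq_sym s3) (negPf n13) (negPf n23).
    by move/eqP.
  have sub (a b a' b' : V) : x + a = y + a' -> x + b = y + b' -> a + b = a' + b'.
    move=> ea eb; have := congr2 +%R ea eb.
    by rewrite (addrACA x a) (addrACA y a') !rowZ2_addrr !add0r.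
  (* Otherwise s1 would equal both r2 and r3. *)
  have r1E : s1 = r1.
    have [[]//|[e12 _]] := sol_unique S1 S2 R1 R2 n12 (sub _ _ _ _ e1 e2).
    have [[]//|[e13 _]] := sol_unique S1 S3 R1 R3 n13 (sub _ _ _ _ e1 e3).
    by rewrite -e12 e13 eqxx in m23.
  have xy : x = y by move: e1; rewrite r1E => /addIr.
  by move: e2 e3; rewrite xy r1E => /addrI-> /addrI->.
rewrite -(card_in_imset f_inj).
apply: (@leq_trans #|[set q : {set V} * (V * V) |
    [&& q.1 \in U, q.2.1 \in q.1 & q.2.2 \in q.1]]|).
  apply/subset_leq_card/subsetP => _ /imsetP[[[[x s1] s2] s3]] + ->.
  by rewrite !inE /= => /and5P[_ _ _ _ ->]; rewrite !eqxx !orbT.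
rewrite -sum1_card.
rewrite (eq_bigl (fun q => (q.1 \in U) && (q.2 \in setX q.1 q.1))); last first.
  by move=> [u [a b]]; rewrite !inE.
rewrite -(pair_big_dep (mem U) (fun u ab => ab \in setX u u) (fun _ _ => 1%N)) /=.
rewrite mulnC -sum_nat_const; apply: leq_sum => u uU.
rewrite sum1_card cardsX.
have /cayley_hypergraphP[x [s1 [s2 [s3 [_ _ ->]]]]] := subsetP UT _ uU.
have le3 : (#|[set (x + s1)%R; (x + s2)%R; (x + s3)%R]| <= 3)%N.
  by rewrite setUC cardsU1 cards2; case: (_ \notin _); case: (_ != _).
exact: (leq_mul le3 le3).
Qed.

(** * Double counting of edges and cherries *)

Section Sums.
Variable R : realType.
Implicit Type F : {set {set V}}.

Definition pair_in F x s s' : R := ([set x + s; x + s'] \in F)%:R.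

Lemma sum_pair_in (F : {set {set V}}) : F \subset skeleton T ->
  \sum_x \sum_(s in S) \sum_(s' in S) pair_in F x s s' = 4 * #|F|%:R.
Proof.
move=> FT.
have pE x s s' : pair_in F x s s' = \sum_(e in F) ([set x + s; x + s'] == e)%:R.
  rewrite /pair_in; case: (boolP (_ \in F)) => [eF|eF].
    by rewrite (bigD1 _ eF) /= eqxx big1 ?addr0 // => e /andP[_ /negPf]; rewrite eq_sym => ->.
  by rewrite big1 // => e eF'; case: eqP => // ee; rewrite ee eF' in eF.
transitivity (\sum_(e in F) \sum_x \sum_(s in S) \sum_(s' in S)
    ([set x + s; x + s'] == e)%:R : R).
  rewrite [RHS]exchange_big; apply: eq_bigr => x _.
  rewrite [RHS]exchange_big; apply: eq_bigr => s _.
  by rewrite [RHS]exchange_big; apply: eq_bigr => s' _.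
rewrite mulr_natr -sumr_const; apply: eq_bigr => e eF.
rewrite -[RHS](congr1 (fun k => k%:R) (pair_preimages (subsetP FT _ eF))).
rewrite -sum1_card natr_sum.
rewrite pair_big_dep pair_big_dep /= [LHS]big_mkcond [RHS]big_mkcond /=.
apply: eq_bigr => -[[x s] s'] _; rewrite inE /=.
by case: (s \in S); case: (s' \in S); case: (_ == e).
Qed.

Lemma pair_in_idem F x s s' : pair_in F x s s' ^+ 2 = pair_in F x s s'.
Proof. by rewrite /pair_in; case: (_ \in _); rewrite ?expr1n ?expr0n. Qed.

Lemma pair_in_sym F x s s' : pair_in F x s s' = pair_in F x s' s.
Proof. by rewrite /pair_in setUC. Qed.

Lemma pair_in_irr F x s : F \subset skeleton T -> pair_in F x s s = 0.
Proof.
move=> /subsetP FT; rewrite /pair_in; case: (boolP (_ \in F)) => // /FT.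
by rewrite inE setUid cards1.
Qed.

Lemma pair_in_swap F x s s' : pair_in F (x + s + s') s s' = pair_in F x s s'.
Proof. by rewrite /pair_in rowZ2_addrK addrAC rowZ2_addrK setUC. Qed.

Lemma sum_neq s : s \in S -> \sum_(s' in S) (s != s')%:R = #|S|%:R - 1 :> R.
Proof.
move=> Ss; rewrite (bigD1 s) //= eqxx add0r.
rewrite (cardsD1 s) Ss natrD [X in X - _]addrC addrK -sum1_card natr_sum.
rewrite big_mkcond [RHS]big_mkcond; apply: eq_bigr => s' _.
by rewrite !inE andbC (eq_sym s); case: eqP => //=; case: (_ \in _).
Qed.

(** Every clique x + S is complete in the skeleton. This converts |F| <= |E| / 2 into mean density
    at most 1/2. *)
Lemma sum_pair_in_skeleton : (2 < #|S|)%N ->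
  4 * #|skeleton T|%:R = #|{: V}|%:R * (#|S|%:R * (#|S|%:R - 1)) :> R.
Proof.
move=> n3; rewrite -sum_pair_in // mulr_natl -sumr_const; apply: eq_bigr => x _.
rewrite mulr_natl -sumr_const; apply: eq_bigr => s Ss.
rewrite -(sum_neq Ss); apply: eq_bigr => s' Ss'.
have [<-|ns] := eqVneq s s'; first by rewrite pair_in_irr.
by rewrite /pair_in skeleton_intro.
Qed.

Section Cherries.
Variable F : {set {set V}}.
Hypotheses (n3 : (2 < #|S|)%N) (FT : F \subset skeleton T).

(* The factor (s1 != s3) - pair_in F x s1 s3 indicates that {x+s1, x+s3} is a  *)
(* skeleton edge outside F.                                                    *)
Definition cherries x : R := \sum_(s1 in S) \sum_(s2 in S) \sum_(s3 in S)
  pair_in F x s1 s2 * ((s1 != s3)%:R - pair_in F x s1 s3).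

Lemma cherriesE x : cherries x = \sum_(s in S)
  (\sum_(s' in S) pair_in F x s s') * (#|S|%:R - 1 - \sum_(s' in S) pair_in F x s s').
Proof.
apply: eq_bigr => s Ss; rewrite -(sum_neq Ss) -sumrB mulr_suml.
by apply: eq_bigr => s2 _; rewrite mulr_sumr.
Qed.

Lemma sum_cherries_ge (eps : R) : 0 < eps ->
    graph_lambda R (cayley S) <= (1 - eps) * #|S|%:R ->
    (2 * #|F| <= #|skeleton T|)%N ->
  eps / 3 * #|S|%:R * #|F|%:R <= \sum_x cherries x.
Proof.
move=> eps0 gap half.
have := dispersion_ge (phi := pair_in F) (pair_in_idem F)
  (fun x s => pair_in_irr x s FT) (pair_in_swap F) n3 eps0 gap (fun _ _ _ => ler0n _ _).
rewrite sum_pair_in // => /(_ _)/wrap[].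
  move: half; rewrite -(ler_nat R) natrM => half.
  by rewrite [leRHS]mulrC -sum_pair_in_skeleton //; lra.
set B := \sum_x _ => leB.
(* The constant is (1 / 2) (eps / 6) 4 = eps / 3, the 4 coming from [sum_pair_in]. *)
apply: (@le_trans _ _ (#|S|%:R / 2 * B)).
  have := ler_wpM2l (ler0n R #|S|) leB; lra.
rewrite mulr_sumr; apply: ler_sum => x _; rewrite cherriesE.
exact: cherries_ge (pair_in_sym F x) (pair_in_idem F x)
  (fun s => pair_in_irr x s FT) n3.
Qed.

Lemma cherryP x s1 s2 s3 : s1 \in S -> s2 \in S -> s3 \in S ->
    [set x + s1; x + s2] \in F -> s1 != s3 -> [set x + s1; x + s3] \notin F ->
  [/\ s1 != s2, s2 != s3, [set x + s1; x + s2; x + s3] \in N_T T F &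
      [set x + s1; x + s3] \in N_E T F].
Proof.
move=> S1 S2 S3 F12 n13 F13.
have n12 : s1 != s2.
  by apply: contraTneq (subsetP FT _ F12) => <-; rewrite inE setUid cards1.
have n23 : s2 != s3 by apply: contraNneq F13 => <-.
have uT : [set x + s1; x + s2; x + s3] \in T.
  by apply/cayley_hypergraphP; exists x, s1, s2, s3.
have sub13 : [set x + s1; x + s3] \subset [set x + s1; x + s2; x + s3].
  by apply/subsetP => z; rewrite !inE => /orP[]->; rewrite ?orbT.
split=> //; rewrite inE.
  apply/andP; split; last by apply/exists_inP; exists [set x + s1; x + s2]; rewrite ?subsetUl.
  rewrite inE uT andbT inE uT /=; apply: contra F13 => /forallP/(_ [set x + s1; x + s3]).
  by rewrite cards2 (inj_eq (addrI x)) n13 sub13.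
rewrite inE F13 skeleton_intro //=; apply/exists_inP; exists [set x + s1; x + s2] => //.
suff -> : [set x + s1; x + s3] :|: [set x + s1; x + s2] = [set x + s1; x + s2; x + s3] by [].
by apply/setP => z; rewrite !inE; do 3![case: eqP => //= _].
Qed.

(** Send a cherry to its edge outside F: the forgotten s2 takes at most |S| values, and each edge
    has 4 representations. *)
Lemma sum_cherries_le_edges : \sum_x cherries x <= 4 * #|S|%:R * #|N_E T F|%:R.
Proof.
have NET : N_E T F \subset skeleton T.
  by apply/subsetP => e; rewrite inE => /andP[]; rewrite inE => /andP[].
have -> : 4 * #|S|%:R * #|N_E T F|%:R = #|S|%:R * (4 * #|N_E T F|%:R) :> R by ring.
rewrite -sum_pair_in // mulr_sumr; apply: ler_sum => x _.
rewrite mulr_sumr; apply: ler_sum => s1 S1.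
rewrite mulr_natl -sumr_const; apply: ler_sum => s2 S2; apply: ler_sum => s3 S3.
rewrite {1 2}/pair_in; case: (boolP (_ \in F)) => F12; last by rewrite mul0r ler0n.
rewrite mul1r; have [<-|n13] := eqVneq s1 s3.
  by apply: le_trans (ler0n _ _); rewrite sub0r oppr_le0 ler0n.
case: (boolP (_ \in F)) => F13; first by rewrite subrr ler0n.
by have [_ _ _ NE] := cherryP S1 S2 S3 F12 n13 F13; rewrite /pair_in NE subr0.
Qed.

(** Send a cherry to the triple it spans, which has at most 9 representations. *)
Lemma sum_cherries_le_triples : \sum_x cherries x <= 9 * #|N_T T F|%:R.
Proof.
have NTT : N_T T F \subset T.
  by apply/subsetP => e; rewrite inE => /andP[]; rewrite inE => /andP[].
have := triple_preimages NTT; rewrite -(ler_nat R) natrM => /(le_trans _); apply.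
rewrite -sum1_card natr_sum /cherries pair_big_dep pair_big_dep pair_big_dep /=.
rewrite big_mkcond [leRHS]big_mkcond; apply: ler_sum => -[[[x s1] s2] s3] _.
rewrite /= inE /=; case: ifP; last by case: ifP.
case/andP=> /andP[S1 S2] S3; rewrite S1 S2 S3 /=.
rewrite /pair_in; case: (boolP (_ \in F)) => F12; last by rewrite mul0r; case: ifP.
rewrite mul1r; have [<-|n13] := eqVneq s1 s3.
  by rewrite sub0r (le_trans (_ : _ <= 0)) ?oppr_le0 //; case: ifP.
case: (boolP (_ \in F)) => F13; first by rewrite subrr; case: ifP.
by have [n12 n23 NT _] := cherryP S1 S2 S3 F12 n13 F13; rewrite n12 n23 NT subr0.
Qed.

End Cherries.
End Sums.
End CayleyHypergraph.

Theorem theorem1p1 (R : realType) (t : nat) (S : {set 'rV['Z_2]_t}) (eps : R)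
    (t_ge1 : (1 <= t)%N)
    (S_sol : no_nontrivial_solution S)
    (eps_gt0 : 0 < eps)
    (S_lambda : graph_lambda R (cayley S) <= (1 - eps) * #|S|%:R) :
  edge_expander (cayley_hypergraph S) (eps ^+ 2 / 128) /\
  triple_expander (cayley_hypergraph S) (eps ^+ 2 / 64 * #|S|%:R).
Proof.
suff expand F : admissible (cayley_hypergraph S) F ->
    eps ^+ 2 / 128 * #|F|%:R <= #|N_E (cayley_hypergraph S) F|%:R /\
    eps ^+ 2 / 64 * #|S|%:R * #|F|%:R <= #|N_T (cayley_hypergraph S) F|%:R.
  (* If no F is admissible the minimum is [+oo] and the bound is immediate. *)
  split; apply: le_bigmin => [|F adF]; rewrite ?leey // lee_fin ler_pdivlMr ?ltr0n ?card_gt0;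
    by [case: (expand F adF) | case/and3P: adF].
case/and3P=> F0 FT half.
have n3 : (2 < #|S|)%N.
  have [e eF] := set0Pn _ F0; have := subsetP FT _ eF.
  by rewrite inE => /andP[_ /exists_inP[u uT _]]; exact: cayley_hypergraph_card_gt2 uT.
have n0 : 0 < #|S|%:R :> R by rewrite ltr0n (ltn_trans _ n3).
have eps1 := spectral_gap_le1 n0 S_lambda.
have ge := sum_cherries_ge S_sol n3 FT eps_gt0 S_lambda half.
have geE := le_trans ge (sum_cherries_le_edges S_sol R n3 FT).
have geT := le_trans ge (sum_cherries_le_triples S_sol R n3 FT).
have eps2 : eps ^+ 2 <= eps by rewrite expr2 ler_piMl // ltW.
have epsF : eps ^+ 2 * #|F|%:R <= eps * #|F|%:R by rewrite ler_wpM2r.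
have F_ge0 : 0 <= eps * #|F|%:R by rewrite mulr_ge0 // ltW.
(* The counts give the factors eps / 12 and eps |S| / 27; eps^2 <= eps then leaves room for both
   constants. *)
split.
  have : eps / 12 * #|F|%:R <= #|N_E (cayley_hypergraph S) F|%:R.
    by rewrite -(ler_pM2l n0); lra.
  by lra.
have := ler_wpM2l (ltW n0) epsF; have := mulr_ge0 (ltW n0) F_ge0.
by lra.
Qed.
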